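(* Let $X$ be a compact metric space and $f:X\to X$ be a homeomorphism. Suppose $(X,f)$ is equicontinuous. Then for every $p\in\beta\mathbb{N}$ one has $(f^p)^{-1}=(f^{-1})^p$ (that is, $f^p$ is a bijection of $X$ whose inverse is the $p$-iterate of $f^{-1}$).
   Context: $\mathbb{N}$ is the set of non-negative integers and $\beta\mathbb{N}$ is the set of all ultrafilters on $\mathbb{N}$ (principal ones included). For $p\in\beta\mathbb{N}$ and a sequence $(x_n)_n$ in $X$, $x=p\text{-}\lim_n x_n$ means that $\{n\in\mathbb{N}: x_n\in V\}\in p$ for every neighborhood $V$ of $x$; this limit exists and is unique in a compact metric space. For a map $g:X\to X$, the $p$-iterate of $g$ is $g^p:X\to X$, $g^p(x)=p\text{-}\lim_n g^n(x)$. With $d$ the metric of $X$, $(X,f)$ is equicontinuous if for every $\varepsilon>0$ there is $\delta>0$ such that for all $x,y\in X$ with $d(x,y)<\delta$ we have $d(f^n(x),f^n(y))<\varepsilon$ for all $n\in\mathbb{Z}$. *)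

(* Defs.v *)
From HB Require Import structures.
From mathcomp Require Import all_boot all_order all_algebra.
From mathcomp Require Import all_classical all_reals.
From mathcomp Require Import topology.

Set Implicit Arguments.
Unset Strict Implicit.
Unset Printing Implicit Defensive.

Import Order.TTheory GRing.Theory Num.Theory.

Local Open Scope classical_set_scope.
Local Open Scope ring_scope.

Record homeomorphism (X Y : topologicalType) := Homeomorphism {
  homeo_fun :> X -> Y;
  homeo_inv : Y -> X;
  homeo_funK : cancel homeo_fun homeo_inv;
  homeo_invK : cancel homeo_inv homeo_fun;
  homeo_continuous : continuous homeo_fun;
  homeo_inv_continuous : continuous homeo_inv
}.

Definition int_iter (X : topologicalType) (f : homeomorphism X X) (n : int) :
    X -> X :=
  match n with
  | Posz k => iter k f
  | Negz k => iter k.+1 (homeo_inv f)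
  end.

Definition equicontinuous_system (R : realType) (X : metricType R)
    (f : homeomorphism X X) : Prop :=
  forall e : R, 0 < e -> exists2 d : R, 0 < d &
    forall x y : X, mdist x y < d ->
      forall n : int, mdist (int_iter f n x) (int_iter f n y) < e.

(* [u @ p --> x] unfolds to: the set of [n] with [u n \in V] belongs to [p] for
   every neighborhood [V] of [x]. The value [u 0] is a junk default, which the
   two lemmas below show to be irrelevant in a compact metric space. It is used
   instead of [lim], which would require [X] to be pointed, hence nonempty. *)
Definition p_lim (X : topologicalType) (p : set_system nat) (u : nat -> X) : X :=
  xget (u 0%N) [set x | u @ p --> x].

Definition p_iterate (X : topologicalType) (p : set_system nat) (g : X -> X) :
    X -> X :=
  fun x => p_lim p (fun n => iter n g x).

Lemma cvg_p_lim (X : topologicalType) (p : set_system nat) (u : nat -> X) :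
  compact [set: X] -> UltraFilter p -> u @ p --> p_lim p u.
Proof.
move=> cX pU; apply: (@xgetPex _ (u 0%N) [set x | u @ p --> x]).
have /cX[x [_ xcl]] : (u @ p) [set: X] by exact: filterT.
exists x => V Vx; rewrite /nbhs/=.
have [//|pnV] := in_ultra_setVsetC (u @^-1` V) pU.
by have [y [nVy Vy]] := xcl (~` V) V pnV Vx.
Qed.

Lemma p_lim_unique (R : realType) (X : metricType R) (p : set_system nat)
    (u : nat -> X) (x : X) :
  UltraFilter p -> u @ p --> x -> p_lim p u = x.
Proof.
move=> pU ux; apply: xget_unique => //= y uy.
have pF : ProperFilter (u @ p) by exact: fmap_proper_filter.
exact: (cvg_unique (@metric_hausdorff R X) uy ux).
Qed.

(* Main.v *)
Require Import Defs.
From HB Require Import structures.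
From mathcomp Require Import all_boot all_order all_algebra.
From mathcomp Require Import all_classical all_reals.
From mathcomp Require Import topology.

Import Order.TTheory GRing.Theory Num.Theory.

Local Open Scope classical_set_scope.
Local Open Scope ring_scope.

(** Put [y := f^p x]. Applying [f^-n] to the pair [(f^n x, y)] turns it into
    [(x, f^-n y)]. By equicontinuity the second pair is as close as one likes,
    with a bound uniform in [n], as soon as the first one is close enough; and
    the first one is close for [p]-almost every [n], by the definition of [y].
    Hence [f^-n y] tends to [x] along [p], that is, the [p]-iterate of [f^-1]
    sends [y] back to [x].

    This argument, [p_iterate_cancel], uses equicontinuity of the iterates of
    the inverse only. Equicontinuity over all integer times is symmetric in [f]
    and [f^-1], so it yields both cancellation identities. *)

(** Compactness makes the orbit of [x] under [g] converge along [p]; the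
    equicontinuous iterates of [h] then carry closeness to the limit back to
    closeness to [x]. *)
Lemma p_iterate_cancel (R : realType) (X : metricType R) (g h : X -> X)
    (p : set_system nat) :
  compact [set: X] -> UltraFilter p -> cancel g h ->
  (forall e : R, 0 < e -> exists2 d : R, 0 < d &
    forall x y : X, mdist x y < d ->
      forall n, mdist (iter n h x) (iter n h y) < e) ->
  cancel (p_iterate p g) (p_iterate p h).
Proof.
move=> cX pU gK equih x; apply: p_lim_unique.
have itergK n : cancel (iter n g) (iter n h).
  by elim: n => // n IHn z; rewrite (iterSr n h) (iterS n g) gK.
apply/cvg_ballP => e e0.
have [d d0 hd] := equih e e0.
have /cvg_ballP/(_ d d0) := @cvg_p_lim X p (fun n => iter n g x) cX pU.
apply: filterS => n /=; rewrite !ballEmdist /= => /hd/(_ n).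
by rewrite itergK metric_sym.
Qed.

Theorem theorem4p4 (R : realType) (X : metricType R)
    (f : homeomorphism X X)
    (compactX : compact [set: X])
    (equif : equicontinuous_system f)
    (p : set_system nat) (ultrap : UltraFilter p) :
  cancel (p_iterate p f) (p_iterate p (homeo_inv f)) /\
  cancel (p_iterate p (homeo_inv f)) (p_iterate p f).
Proof.
split; apply: p_iterate_cancel => //.
- exact: homeo_funK.
- move=> e e0; have [d d0 fd] := equif e e0; exists d => // x y xy [|n].
    (* [Negz n] stands for [-(n+1)], so time 0 is a nonnegative time. *)
    exact: (fd x y xy (Posz 0)).
  exact: (fd x y xy (Negz n)).
- exact: homeo_invK.
- move=> e e0; have [d d0 fd] := equif e e0; exists d => // x y xy n.
  exact: (fd x y xy (Posz n)).
Qed.
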